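(* Let $\mathbf{A}<_M\mathbf{B}$ be Medvedev degrees. Then either the interval $[\mathbf{A},\mathbf{B}]$ is isomorphic to the Boolean algebra $\mathfrak{2}^n$ for some $n\geq1$, or $[\mathbf{A},\mathbf{B}]$ contains an antichain (a set of pairwise $\leq_M$-incomparable elements) of cardinality $2^{2^{\aleph_0}}$.
   Context: A mass problem is a subset of $\omega^\omega$. $\mathcal{A}\leq_M\mathcal{B}$ means there is a partial computable functional $\Psi$ defined on all of $\mathcal{B}$ with $\Psi(\mathcal{B})\subseteq\mathcal{A}$; Medvedev degrees are the $\equiv_M$-equivalence classes of mass problems, ordered by the induced order $\leq_M$. $[\mathbf{A},\mathbf{B}]=\{\mathbf{C}:\mathbf{A}\leq_M\mathbf{C}\leq_M\mathbf{B}\}$. $\mathfrak{2}^n$ is the Boolean algebra of all subsets of $\{0,\ldots,n-1\}$ under inclusion. *)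

(* Defs.v *)
From mathcomp Require Import all_boot.
From mathcomp Require Import boolp classical_sets functions cardinality.

Set Implicit Arguments.
Unset Strict Implicit.
Unset Printing Implicit Defensive.

Local Open Scope classical_set_scope.

(* Kleene's mu-recursive functions relative to an oracle. Programs carry no
   arity: they act on argument lists, and a missing argument reads as 0. *)
Inductive program : Type :=
| Zero
| Succ
| Query
| Proj of nat
| Comp of program & seq program
| PrimRec of program & program
| Mu of program.

(* [run g p v y]: with oracle [g], program [p] halts on arguments [v] with
   output [y]. Primitive recursion and minimization are on the first
   argument; [PrimRec b s] satisfies F(0, u) = b(u) and
   F(k+1, u) = s(k, F(k, u), u). *)
Fixpoint run (g : nat -> nat) (p : program) (v : seq nat) (y : nat) : Prop :=
  match p with
  | Zero => y = 0
  | Succ => y = (head 0 v).+1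
  | Query => y = g (head 0 v)
  | Proj i => y = nth 0 v i
  | Comp h qs => exists2 w : seq nat,
      (fix run_all (qs : seq program) (w : seq nat) : Prop :=
         match qs, w with
         | [::], [::] => True
         | q :: qs', z :: w' => run g q v z /\ run_all qs' w'
         | _, _ => False
         end) qs w
      & run g h w y
  | PrimRec b s =>
      (fix rec (k y : nat) : Prop :=
         match k with
         | 0 => run g b (behead v) y
         | k'.+1 => exists2 z, rec k' z & run g s [:: k', z & behead v] y
         end) (head 0 v) y
  | Mu q => run g q (y :: v) 0 /\
      (forall z, z < y -> exists t, run g q (z :: v) t.+1)
  end.

(* The graph of the partial computable functional on Baire space given by [p];
   it is undefined at [g] as soon as [p] with oracle [g] diverges on some [n]. *)
Definition functional (p : program) (g f : nat -> nat) : Prop :=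
  forall n, run g p [:: n] (f n).

Definition mass_problem : Type := set (nat -> nat).

Definition medvedev_le (A B : mass_problem) : Prop :=
  exists p : program,
    (forall g, B g -> exists f, functional p g f) /\
    (forall g f, B g -> functional p g f -> A f).

Definition medvedev_equiv (A B : mass_problem) : Prop :=
  medvedev_le A B /\ medvedev_le B A.

Record medvedev_degree : Type := MedvedevDegree {
  degree_class : set mass_problem;
  degree_classP : exists A, degree_class = [set X | medvedev_equiv A X] }.

Definition degree_le (a b : medvedev_degree) : Prop :=
  exists A B : mass_problem, [/\ degree_class a A, degree_class b B & medvedev_le A B].

Definition degree_lt (a b : medvedev_degree) : Prop :=
  degree_le a b /\ ~ degree_le b a.

Definition degree_interval (a b : medvedev_degree) : set medvedev_degree :=
  [set c | degree_le a c /\ degree_le c b].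

Definition iso_powerset (n : nat) (I : set medvedev_degree) : Prop :=
  exists phi : {set 'I_n} -> medvedev_degree,
    set_bij [set: {set 'I_n}] I phi /\
    (forall S T : {set 'I_n}, S \subset T <-> degree_le (phi S) (phi T)).

Definition degree_antichain (C : set medvedev_degree) : Prop :=
  forall c d, C c -> C d -> c <> d -> ~ degree_le c d /\ ~ degree_le d c.

(* Main.v *)
(* A finite meet is a mass problem {0^b : b in B} together with finitely many
   points (i+1)^(F i); below, f + h is the join of f and h.

   Suppose first that no finite meet of B with points of A reduces to A.  Going
   through all programs, choose points f_k of A and fresh tags n_k such that
   the k-th program, applied to x_k = (n_k+1)^(f_k + 0), reaches neither B nor
   an earlier x_i; put x_k in every mass problem of the family, unless the
   program fixes it.  In that case use f_k + 0^u 1 h_a for all u and all a in I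
   instead, where (h_a) is a perfect family of mutually independent functions:
   by continuity the program keeps the tag when u is large, so it would have to
   compute some h_b, b in I', from h_a.  So the meets of B with these families
   are incomparable for incomparable sets I of indices.

   Otherwise A is a finite meet of B with points F i, i in a minimal set S.  If
   B reduces to the strict Turing cone above every F i, the interval consists
   of the meets over the subsets of S.  If B does not reduce to the strict cone
   above f = F i, the first case applies to this cone: a reduction of a finite
   meet to it which reaches a point e of the cone does so on a neighbourhood,
   and a search among the f-computable elements there computes e from f. *)

Require Import Defs.
From mathcomp Require Import all_boot.
From mathcomp Require Import boolp classical_sets functions cardinality.
From mathcomp Require Import zify.

Set Implicit Arguments.
Unset Strict Implicit.
Unset Printing Implicit Defensive.

Local Open Scope classical_set_scope.
Local Open Scope card_scope.

(** * Programs *)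

(** The principle generated for [program] says nothing about the list under [Comp]. Here its
    hypothesis is a conjunction over that list, which an inner induction on [qs] takes apart. *)
Lemma program_nested_ind (P : program -> Prop) :
  P Zero -> P Succ -> P Query -> (forall i, P (Proj i)) ->
  (forall h qs, P h -> foldr (fun q => and (P q)) True qs -> P (Comp h qs)) ->
  (forall b s, P b -> P s -> P (PrimRec b s)) ->
  (forall q, P q -> P (Mu q)) -> forall p, P p.
Proof.
move=> H0 H1 H2 H3 H4 H5 H6; fix IH 1 => -[| | |i|h qs|b s|q].
- exact: H0.
- exact: H1.
- exact: H2.
- exact: H3.
- apply: H4; first exact: IH.
  by elim: qs => [|q qs IHqs] /=; [|split; [exact: IH|]].
- by apply: H5; exact: IH.
- by apply: H6; exact: IH.
Qed.

(** Named copies of the two anonymous fixpoints inside [run]; the equations below hold by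
    conversion. *)
Definition run_all (g : nat -> nat) (v : seq nat) :=
  fix run_all (qs : seq program) (w : seq nat) : Prop :=
    match qs, w with
    | [::], [::] => True
    | q :: qs', z :: w' => run g q v z /\ run_all qs' w'
    | _, _ => False
    end.

Definition run_rec (g : nat -> nat) (b s : program) (u : seq nat) :=
  fix rec (k y : nat) : Prop :=
    match k with
    | 0 => run g b u y
    | k'.+1 => exists2 z, rec k' z & run g s [:: k', z & u] y
    end.

Lemma run_CompE g h qs v y :
  run g (Comp h qs) v y = exists2 w, run_all g v qs w & run g h w y.
Proof. by []. Qed.

Lemma run_PrimRecE g b s v y :
  run g (PrimRec b s) v y = run_rec g b s (behead v) (head 0 v) y.
Proof. by []. Qed.

Lemma run_det g p v y y' : run g p v y -> run g p v y' -> y = y'.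
Proof.
elim/program_nested_ind: p v y y' => [||||h qs IHh IHqs|b s IHb IHs|q IHq] v y y'.
1-4: by move=> /= *; subst.
- rewrite !run_CompE => -[w rw hw] [w' rw' hw'].
  suff ew : w = w' by subst; exact: IHh hw hw'.
  elim: qs IHqs w w' rw rw' {hw hw'} => [_|q qs IH [IHq IHqs]] [|z w] [|z' w'] //=.
  by move=> [qz rw] [qz' rw']; rewrite (IHq _ _ _ qz qz') (IH IHqs _ _ rw rw').
- rewrite !run_PrimRecE; elim: (head 0 v) y y' => [|k IHk] y y' /=; first exact: IHb.
  move=> [z rz sz] [z' rz' sz']; move: (IHk _ _ rz rz') => ?; subst.
  exact: IHs sz sz'.
- move=> /= [q0 ql] [q0' ql']; case: (ltngtP y y') => // lt.
  + by have [t /IHq-/(_ _ q0)] := ql' _ lt.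
  + by have [t /IHq-/(_ _ q0')] := ql _ lt.
Qed.

Lemma functional_unique p g f f' : functional p g f -> functional p g f' -> f = f'.
Proof. by move=> pf pf'; apply/funext => n; exact: run_det (pf n) (pf' n). Qed.

Lemma run_Comp1 g h q v a y :
  run g q v a -> run g h [:: a] y -> run g (Comp h [:: q]) v y.
Proof. by move=> qa hy; rewrite run_CompE; exists [:: a]. Qed.

Lemma run_Comp2 g h q q' v a a' y :
  run g q v a -> run g q' v a' -> run g h [:: a; a'] y ->
  run g (Comp h [:: q; q']) v y.
Proof. by move=> qa qa' hy; rewrite run_CompE; exists [:: a; a']. Qed.

Lemma run_PrimRec0 g b s u y : run g b u y -> run g (PrimRec b s) (0 :: u) y.
Proof. by []. Qed.

Lemma run_PrimRecS g b s k u z y :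
  run g (PrimRec b s) (k :: u) z -> run g s [:: k, z & u] y ->
  run g (PrimRec b s) (k.+1 :: u) y.
Proof. by move=> rz sy; exists z. Qed.

Fixpoint prog_const n : program :=
  if n is n'.+1 then Comp Succ [:: prog_const n'] else Zero.

Lemma run_const g n v : run g (prog_const n) v n.
Proof. by elim: n => [|n IH]; [|exact: run_Comp1 IH _]. Qed.

Definition prog_pred := PrimRec Zero (Proj 0).

Lemma run_pred g x : run g prog_pred [:: x] x.-1.
Proof.
(* The last step outputs the counter, but the recursion below it still has to halt. *)
rewrite run_PrimRecE; case: x => //= x; suff [z] : exists z, run_rec g Zero (Proj 0) [::] x z by exists z.
by elim: x => [|x [z rz]] /=; [exists 0|exists x; exists z].
Qed.

Definition prog_add := PrimRec (Proj 0) (Comp Succ [:: Proj 1]).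

Lemma run_add g x y : run g prog_add [:: x; y] (x + y).
Proof.
rewrite run_PrimRecE /=; elim: x => //= x IH; exists (x + y) => //.
by exists [:: x + y].
Qed.

Definition prog_mul := PrimRec Zero (Comp prog_add [:: Proj 1; Proj 2]).

Lemma run_mul g x y : run g prog_mul [:: x; y] (x * y).
Proof.
rewrite run_PrimRecE; elim: x => // x IH; exists (x * y) => //.
by apply: (@run_Comp2 _ _ _ _ _ (x * y) y) => //; rewrite mulSn addnC; exact: run_add.
Qed.

Definition prog_rsub := PrimRec (Proj 0) (Comp prog_pred [:: Proj 1]).

Lemma run_rsub g x y : run g prog_rsub [:: x; y] (y - x).
Proof.
rewrite run_PrimRecE; elim: x => [|x IH]; first by rewrite subn0.
exists (y - x) => //; apply: (@run_Comp1 _ _ _ _ (y - x)) => //.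
by rewrite subnS; exact: run_pred.
Qed.

Definition prog_sub := Comp prog_rsub [:: Proj 1; Proj 0].

Lemma run_sub g x y : run g prog_sub [:: x; y] (x - y).
Proof. by apply: (@run_Comp2 _ _ _ _ _ y x) => //; exact: run_rsub. Qed.

Definition prog_pos := PrimRec Zero (prog_const 1).

Lemma run_pos g x : run g prog_pos [:: x] (0 < x).
Proof.
rewrite run_PrimRecE; elim: x => // x IH; exists (0 < x : nat) => //.
exact: run_const.
Qed.

Definition prog_odd := PrimRec Zero (Comp prog_sub [:: prog_const 1; Proj 1]).

Lemma run_odd g x : run g prog_odd [:: x] (odd x).
Proof.
rewrite run_PrimRecE; elim: x => // x IH; exists (odd x : nat) => //.
apply: (@run_Comp2 _ _ _ _ _ 1 (odd x)) => //; first exact: run_const.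
rewrite oddS (_ : ~~ odd x = 1 - odd x :> nat); first exact: run_sub.
by case: (odd x).
Qed.

Definition prog_half := PrimRec Zero (Comp prog_add [:: Comp prog_odd [:: Proj 0]; Proj 1]).

Lemma run_half g x : run g prog_half [:: x] x./2.
Proof.
rewrite run_PrimRecE; elim: x => // x IH; exists x./2 => //.
apply: (@run_Comp2 _ _ _ _ _ (odd x) x./2) => //.
  by apply: (@run_Comp1 _ _ _ _ x) => //; exact: run_odd.
by rewrite [x.+1./2]uphalf_half; exact: run_add.
Qed.

(* Primitive recursion always evaluates its base case, so [p] is first guarded
   by a recursion of length [1 - c], which leaves it untouched unless [c] is 0. *)
Definition prog_cond c p q :=
  Comp (PrimRec
          (Comp (PrimRec Zero (Comp p [:: Proj 2]))
                [:: Comp prog_sub [:: prog_const 1; c]; Proj 0])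
          (Comp q [:: Proj 2]))
       [:: c; Proj 0].

Lemma run_cond0 g c p q n y :
  run g c [:: n] 0 -> run g p [:: n] y -> run g (prog_cond c p q) [:: n] y.
Proof.
move=> c0 py; apply: (@run_Comp2 _ _ _ _ _ 0 n) => //; apply: run_PrimRec0.
apply: (@run_Comp2 _ _ _ _ _ 1 n) => //.
  by apply: run_Comp2 (run_const _ _ _) c0 _; exact: (run_sub g 1 0).
by apply: (@run_PrimRecS _ _ _ _ _ 0) => //; apply: (@run_Comp1 _ _ _ _ n).
Qed.

Lemma run_condS g c p q n k y :
  run g c [:: n] k.+1 -> run g q [:: n] y -> run g (prog_cond c p q) [:: n] y.
Proof.
move=> ck qy; apply: (@run_Comp2 _ _ _ _ _ k.+1 n) => //.
set b := Comp _ [:: Comp _ _; _]; have b0 : run g b [:: n] 0.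
  apply: (@run_Comp2 _ _ _ _ _ 0 n) => //.
  by apply: run_Comp2 (run_const _ _ _) ck _; exact: (run_sub g 1 k.+1).
have [z rz] : exists z, run g (PrimRec b (Comp q [:: Proj 2])) [:: k; n] z.
  elim: k {ck} => [|k [z rz]]; first by exists 0.
  by exists y; apply: run_PrimRecS rz _; apply: (@run_Comp1 _ _ _ _ n).
by apply: run_PrimRecS rz _; apply: (@run_Comp1 _ _ _ _ n).
Qed.

(** * Functionals *)

Fixpoint oracle_subst (q p : program) : program :=
  match p with
  | Query => Comp q [:: Proj 0]
  | Comp h qs => Comp (oracle_subst q h) (map (oracle_subst q) qs)
  | PrimRec b s => PrimRec (oracle_subst q b) (oracle_subst q s)
  | Mu p' => Mu (oracle_subst q p')
  | _ => p
  end.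

Lemma run_oracle_subst q g f p v y :
  functional q g f -> run f p v y -> run g (oracle_subst q p) v y.
Proof.
move=> qf; elim/program_nested_ind: p v y => [|||i|h qs IHh IHqs|b s IHb IHs|p IHp] v y //.
- by move=> -> /=; exists [:: head 0 v]; [case: v|exact: qf].
- move=> [w rw hw]; exists w; last exact: IHh.
  elim: qs IHqs w rw {hw} => [_|p qs IH [IHp IHqs]] [|z w] //= [pz rw].
  by split; [exact: IHp|exact: IH].
- rewrite /=; elim: (head 0 v) y => [|k IHk] y /=; first exact: IHb.
  by move=> [z /IHk rz sz]; exists z => //; exact: IHs.
- move=> [p0 pl]; split; first exact: IHp.
  by move=> z /pl[t pt]; exists t; exact: IHp.
Qed.

Lemma functional_comp q p g f e :
  functional q g f -> functional p f e -> functional (oracle_subst q p) g e.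
Proof. by move=> qf pe n; apply: run_oracle_subst qf (pe n). Qed.

Lemma functional_id g : functional Query g g.
Proof. by []. Qed.

Definition scons (n : nat) (f : nat -> nat) : nat -> nat :=
  fun i => if i is j.+1 then f j else n.

Definition stail (f : nat -> nat) : nat -> nat := fun i => f i.+1.

Definition join (f h : nat -> nat) : nat -> nat :=
  fun n => if odd n then h n./2 else f n./2.

Lemma scons_stail g : scons (g 0) (stail g) = g.
Proof. by apply/funext => -[]. Qed.

Lemma join_even f h n : join f h (n + n) = f n.
Proof. by rewrite /join addnn odd_double doubleK. Qed.

Lemma join_odd f h n : join f h (n + n).+1 = h n.
Proof. by rewrite /join addnn /= odd_double /= uphalf_double. Qed.

Definition prog_tail := Comp Query [:: Succ].

Lemma functional_tail g : functional prog_tail g (stail g).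
Proof. by move=> n; apply: (@run_Comp1 _ _ _ _ n.+1). Qed.

Definition prog_cons n p := PrimRec (prog_const n) (Comp p [:: Proj 0]).

Lemma functional_cons n p g f :
  functional p g f -> functional (prog_cons n p) g (scons n f).
Proof.
move=> pf; elim => [|i IH]; first exact: (run_const g n [::]).
by apply: run_PrimRecS IH _; apply: (@run_Comp1 _ _ _ _ i).
Qed.

Definition prog_join p q :=
  Comp prog_add
    [:: Comp prog_mul [:: prog_odd; Comp q [:: prog_half]];
        Comp prog_mul [:: Comp prog_sub [:: prog_const 1; prog_odd]; Comp p [:: prog_half]]].

Lemma functional_join p q g f h :
  functional p g f -> functional q g h -> functional (prog_join p q) g (join f h).
Proof.
move=> pf qh n.
(* The case distinction becomes arithmetic: both programs run at [n./2], and both halt there. *)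
have -> : join f h n = odd n * h n./2 + (1 - odd n) * f n./2.
  by rewrite /join; case: odd; rewrite ?mul0n ?mul1n ?addn0 ?add0n.
apply: run_Comp2 (run_add _ _ _).
- apply: run_Comp2 (run_odd _ _) _ (run_mul _ _ _).
  exact: run_Comp1 (run_half _ _) (qh _).
- apply: run_Comp2 _ _ (run_mul _ _ _).
  + exact: run_Comp2 (run_const _ _ _) (run_odd _ _) (run_sub _ _ _).
  + exact: run_Comp1 (run_half _ _) (pf _).
Qed.

Definition prog_left := Comp Query [:: Comp prog_add [:: Proj 0; Proj 0]].

Lemma functional_left f h : functional prog_left (join f h) f.
Proof.
move=> n; apply: (@run_Comp1 _ _ _ _ (n + n)); last by rewrite /= join_even.
by apply: (@run_Comp2 _ _ _ _ _ n n) => //; exact: run_add.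
Qed.

Definition prog_right := Comp Query [:: Comp Succ [:: Comp prog_add [:: Proj 0; Proj 0]]].

Lemma functional_right f h : functional prog_right (join f h) h.
Proof.
move=> n; apply: (@run_Comp1 _ _ _ _ (n + n).+1); last by rewrite /= join_odd.
apply: (@run_Comp1 _ _ _ _ (n + n)) => //.
by apply: (@run_Comp2 _ _ _ _ _ n n) => //; exact: run_add.
Qed.

Definition turing_le (f g : nat -> nat) : Prop := exists p, functional p g f.

Lemma turing_le_trans f g h : turing_le f g -> turing_le g h -> turing_le f h.
Proof. by move=> [p pf] [q qg]; exists (oracle_subst q p); exact: functional_comp qg pf. Qed.

(** * Medvedev reducibility *)

(** Outputs are unique, so definedness and membership merge into one existential. *)
Lemma medvedev_leP A B : medvedev_le A B <->
  exists p, forall g, B g -> exists2 f, A f & functional p g f.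
Proof.
split=> -[p].
- by move=> [pdef pA]; exists p => g Bg; have [f pf] := pdef _ Bg; exists f => //; exact: pA pf.
- move=> pA; exists p; split=> [g /pA[f _ pf]|g f Bg pf]; first by exists f.
  by have [f' Af' pf'] := pA _ Bg; rewrite (functional_unique pf pf').
Qed.

Lemma medvedev_le_sub (A B : mass_problem) : B `<=` A -> medvedev_le A B.
Proof. by move=> BA; apply/medvedev_leP; exists Query => g /BA Ag; exists g. Qed.

Lemma medvedev_le_refl A : medvedev_le A A.
Proof. exact: medvedev_le_sub. Qed.

Lemma medvedev_le_trans A B C : medvedev_le A B -> medvedev_le B C -> medvedev_le A C.
Proof.
move=> /medvedev_leP[p pA] /medvedev_leP[q qB]; apply/medvedev_leP.
exists (oracle_subst q p) => g /qB[f /pA[e Ae pe] qf].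
by exists e => //; exact: functional_comp qf pe.
Qed.

Lemma medvedev_le_set1 A f g : A f -> turing_le f g -> medvedev_le A [set g].
Proof. by move=> Af [p pf]; apply/medvedev_leP; exists p => _ ->; exists f. Qed.

(** Finitely many reductions fit into one program, which first computes the label of its oracle by
    [c] and then branches. Reductions out of finite meets are built in this way, with the tag as
    label. *)
Lemma medvedev_le_cases (X Y : mass_problem) (c : program) k :
  (forall x, X x -> exists2 j, j < k & run x c [:: 0] j) ->
  (forall j, j < k -> medvedev_le Y [set x | X x /\ run x c [:: 0] j]) ->
  medvedev_le Y X.
Proof.
move=> cX YX; suff /medvedev_leP[p pY] :
    medvedev_le Y [set x | X x /\ exists2 j, j < k & run x c [:: 0] j].
  by apply/medvedev_leP; exists p => x Xx; apply: pY; split=> //; exact: cX.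
elim: k YX {cX} => [|k IH] YX.
  by apply/medvedev_leP; exists Query => x [_ []].
have /medvedev_leP[p pY] := IH (fun j jk => YX j (ltnW jk)).
have /medvedev_leP[q qY] := YX k (ltnSn k).
apply/medvedev_leP.
(* Among labels [j <= k], the difference [k - j] vanishes only at [j = k]. *)
exists (prog_cond (Comp prog_sub [:: prog_const k; Comp c [:: Zero]]) q p).
move=> x [Xx [j jk cj]].
have cond n : run x (Comp prog_sub [:: prog_const k; Comp c [:: Zero]]) [:: n] (k - j).
  apply: run_Comp2 (run_const _ _ _) _ (run_sub _ _ _).
  by apply: (@run_Comp1 _ _ _ _ 0).
move: jk; rewrite ltnS leq_eqVlt => /predU1P[jk|jk].
- have [|f Yf qf] := qY x; first by rewrite -jk.
  exists f => // n; apply: run_cond0 (qf n).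
  by rewrite -[X in run _ _ _ X](subnn j) {1}jk.
- have [|f Yf pf] := pY x; first by split=> //; exists j.
  exists f => // n; apply: (@run_condS _ _ _ _ _ (k - j).-1) (pf n).
  by rewrite prednK ?subn_gt0//; exact: cond.
Qed.

(** * Bounded evaluation *)

(* [eval g w p v] is [y.+1] if the computation of [p] on [v] halts with output
   [y] while every minimization searches up to [w], and 0 if it does not. *)
Fixpoint eval (g : nat -> nat) (w : nat) (p : program) (v : seq nat) : nat :=
  match p with
  | Zero => 1
  | Succ => (head 0 v).+2
  | Query => (g (head 0 v)).+1
  | Proj i => (nth 0 v i).+1
  | Comp h qs =>
      let rs := [seq eval g w q v | q <- qs] in
      (0 < \prod_(r <- rs) r) * eval g w h (map predn rs)
  | PrimRec b s =>
      iteri (head 0 v)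
        (fun k r => (0 < r) * eval g w s [:: k, r.-1 & behead v])
        (eval g w b (behead v))
  | Mu q =>
      let y := find (fun y => eval g w q (y :: v) <= 1) (iota 0 w) in
      (eval g w q (y :: v) == 1) * y.+1
  end.

Lemma find_iota_before (a : pred nat) w z : z < find a (iota 0 w) -> ~~ a z.
Proof.
move=> zlt; have := before_find 0 zlt; rewrite nth_iota ?add0n => [->//|].
by rewrite (leq_trans zlt)// -[X in _ <= X](size_iota 0) find_size.
Qed.

Lemma find_iotaE (a : pred nat) w y :
  y < w -> a y -> (forall z, z < y -> ~~ a z) -> find a (iota 0 w) = y.
Proof.
move=> yw ay before; apply/eqP; rewrite eqn_leq; apply/andP; split.
  by rewrite leqNgt; apply/negP => /find_iota_before; rewrite ay.
rewrite leqNgt; apply/negP => lt; have := before _ lt.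
rewrite -{1}[find _ _]add0n -(nth_iota 0 0 (ltn_trans lt yw)) nth_find//.
by apply/hasP; exists y => //; rewrite mem_iota.
Qed.

Lemma eval_sound g w p v y : eval g w p v = y.+1 -> run g p v y.
Proof.
elim/program_nested_ind: p v y => [|||i|h qs IHh IHqs|b s IHb IHs|q IHq] v y.
1-4: by move=> /= -[<-].
- rewrite /=; set rs := map _ _; case: (posnP (\prod_(r <- rs) r)) => // rs_gt0.
  rewrite mul1n => /IHh hy; exists (map predn rs) => //.
  elim: qs IHqs @rs rs_gt0 {hy} => [//|q qs IH] [IHq IHqs] /=.
  rewrite big_cons muln_gt0 => /andP[q_gt0 qs_gt0]; split; last exact: IH.
  by apply: IHq; rewrite prednK.
- rewrite run_PrimRecE /=; elim: (head 0 v) y => [|k IHk] y; first exact: IHb.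
  rewrite iteriS; set r := iteri k _ _; case: (posnP r) => // r_gt0.
  rewrite mul1n => /IHs sy; exists r.-1 => //; apply: IHk.
  by rewrite -/r prednK.
(* The search stops at a value 0 ([eval] is 1) or at a failure ([eval] is 0); the test [== 1]
   excludes the latter. If it exhausts the range, then [z = w], and a value 0 there is still
   preceded by positive values only. *)
- rewrite /=; set z := find _ _.
  case: eqP => // q1; rewrite mul1n => -[zy]; rewrite -zy; split; first exact: IHq.
  move=> t /find_iota_before; case E: eval => [|[|r]] // _; exists r; exact: IHq.
Qed.

(** Truth along the filter of large search bounds and small neighbourhoods of [g] in Baire space; a
    single [m] measures both. *)
Definition eventually_near (g : nat -> nat) (Q : nat -> (nat -> nat) -> Prop) :=
  exists m, forall w g', m <= w -> (forall i, i < m -> g' i = g i) -> Q w g'.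

Lemma eventually_nearI g (Q1 Q2 Q : nat -> (nat -> nat) -> Prop) :
  (forall w g', Q1 w g' -> Q2 w g' -> Q w g') ->
  eventually_near g Q1 -> eventually_near g Q2 -> eventually_near g Q.
Proof.
move=> imp [m1 H1] [m2 H2]; exists (maxn m1 m2) => w g'.
rewrite geq_max => /andP[m1w m2w] ag; apply: imp; [apply: H1 => //|apply: H2 => //];
  by move=> i im; apply: ag; rewrite leq_max im ?orbT.
Qed.

Lemma eventually_near_all g (Q : nat -> nat -> (nat -> nat) -> Prop) k :
  (forall z, z < k -> eventually_near g (Q z)) ->
  eventually_near g (fun w g' => forall z, z < k -> Q z w g').
Proof.
elim: k => [|k IH] nearQ; first by exists 0.
apply: (@eventually_nearI g _ _ _ _ (IH _) (nearQ k _)) => //.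
- by move=> w g' H1 H2 z; rewrite ltnS leq_eqVlt => /predU1P[->|/H1].
- by move=> z zk; apply: nearQ; rewrite ltnW.
Qed.

(** A halting computation makes finitely many queries and searches, so the maximum of the moduli of
    its subcomputations works. *)
Lemma eval_complete g p v y :
  run g p v y -> eventually_near g (fun w g' => eval g' w p v = y.+1).
Proof.
elim/program_nested_ind: p v y => [|||i|h qs IHh IHqs|b s IHb IHs|q IHq] v y.
- by move=> /= ->; exists 0.
- by move=> /= ->; exists 0.
- by move=> /= ->; exists (head 0 v).+1 => w g' _ ->.
- by move=> /= ->; exists 0.
- move=> [u ru /IHh]; apply: (@eventually_nearI _
    (fun w g' => [seq eval g' w q v | q <- qs] = map succn u)).
    move=> w g' /= ->; rewrite mapK// => ->; rewrite (_ : 0 < _) ?mul1n// big_map.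
    by elim: (u) => [|z u' IH]; rewrite ?big_nil// big_cons muln_gt0.
  elim: qs IHqs u ru => [_|q qs IH [IHq IHqs]] [|z u] //; first by exists 0.
  move=> [/IHq qz /IH-/(_ IHqs)]; apply: eventually_nearI qz => w g' /= ->.
  by move=> ->.
- rewrite run_PrimRecE /=; elim: (head 0 v) y => [|k IHk] y; first exact: IHb.
  move=> [z /IHk rz /IHs]; apply: eventually_nearI rz => w g' Hz Hy.
  by rewrite iteriS Hz /= mul1n.
- move=> [/IHq q0 ql].
  have near_ql z : z < y -> eventually_near g (fun w g' => 1 < eval g' w q (z :: v)).
    by move=> /ql[t /IHq[m Hm]]; exists m => w g' mw ag; rewrite Hm.
  have near_q0 : eventually_near g (fun w g' => y < w /\ eval g' w q (y :: v) = 1).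
    have [m Hm] := q0; exists (maxn m y.+1) => w g'; rewrite geq_max => /andP[mw yw] ag.
    by split=> //; apply: Hm => // i im; apply: ag; rewrite leq_max im.
  apply: eventually_nearI (eventually_near_all near_ql) near_q0 => w g' before [yw qy].
  rewrite /= (@find_iotaE _ _ y) ?qy ?mul1n// => z /before; by rewrite -ltnNge.
Qed.

Lemma run_continuous g p v y :
  run g p v y -> exists m, forall g', (forall i, i < m -> g' i = g i) -> run g' p v y.
Proof.
move=> /eval_complete[m Hm]; exists m => g' ag.
by apply: (@eval_sound _ m); exact: Hm.
Qed.

(** Programs have no arity, but each mentions finitely many argument positions. This allows
    [eval_program] to hand over lists of arbitrary length by finitely many projections. *)
Lemma eval_ext p : exists N, forall v v', (forall i, i < N -> nth 0 v i = nth 0 v' i) ->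
  forall g w, eval g w p v = eval g w p v'.
Proof.
elim/program_nested_ind: p => [||||h qs _ IHqs|b s [Nb IHb] [Ns IHs]|q [N IHq]].
- by exists 0.
- by exists 1 => v v' /(_ 0 isT) e g w /=; rewrite -!nth0 e.
- by exists 1 => v v' /(_ 0 isT) e g w /=; rewrite -!nth0 e.
- by move=> i; exists i.+1 => v v' /(_ i (ltnSn i)) e g w /=; rewrite e.
- suff [N HN] : exists N, forall v v', (forall i, i < N -> nth 0 v i = nth 0 v' i) ->
      forall g w, [seq eval g w q v | q <- qs] = [seq eval g w q v' | q <- qs].
    by exists N => v v' ag g w /=; rewrite (HN _ _ ag).
  elim: qs IHqs => [_|q qs IH [[N1 H1] /IH[N2 H2]]]; first by exists 0.
  exists (maxn N1 N2) => v v' ag g w /=.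
  by congr cons; [apply: H1|apply: H2] => i iN; apply: ag; rewrite leq_max iN ?orbT.
- exists (maxn Nb Ns).+1 => v v' ag g w /=.
  have ag' i : i < maxn Nb Ns -> nth 0 (behead v) i = nth 0 (behead v') i.
    by move=> iN; rewrite !nth_behead; apply: ag.
  rewrite -!nth0 (ag 0)//; elim: (nth 0 v' 0) => [|k IHk].
    by apply: IHb => i iN; apply: ag'; rewrite leq_max iN.
  rewrite !iteriS IHk; congr (_ * _); apply: IHs => -[|[|i]] //= iN; apply: ag'.
  by rewrite leq_max; apply/orP; right; lia.
- exists N => v v' ag g w /=.
  have e z : eval g w q (z :: v) = eval g w q (z :: v').
    by apply: IHq => -[|i] //= iN; apply: ag; lia.
  by rewrite e (eq_find (a2 := fun y => eval g w q (y :: v') <= 1))// => z; rewrite e.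
Qed.

Lemma run_all_Proj g v a N :
  run_all g v [seq Proj i | i <- iota a N] [seq nth 0 v i | i <- iota a N].
Proof. by elim: N a => //= N IH a; split. Qed.

Lemma nth_map_iota (v : seq nat) a N i : i < N ->
  nth 0 [seq nth 0 v j | j <- iota a N] i = nth 0 v (a + i).
Proof. by move=> iN; rewrite (nth_map 0) ?size_iota// nth_iota. Qed.

(** * Bounded evaluation is itself computable *)

Section EvalProgram.
Variables (f : nat -> nat) (O : nat -> nat -> nat) (o : program).
Hypothesis run_o : forall w n, run f o [:: n; w] (O w n).

(** Bounded evaluation always terminates, so it can be programmed by recursion on [p]. The bound [w]
    also selects the oracle [O w]: a single search over [w] then ranges over oracles and running
    times together. *)
Lemma eval_program p :
  exists p', forall w v, run f p' (w :: v) (eval (O w) w p v).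
Proof.
elim/program_nested_ind: p => [||||h qs [h' IHh] IHqs|b s [b' IHb] [s' IHs]|q [q' IHq]].
- by exists (prog_const 1) => w v; exact: run_const.
- exists (Comp Succ [:: Comp Succ [:: Proj 1]]) => w v.
  by apply: (@run_Comp1 _ _ _ _ (head 0 v).+1) => //; apply: (@run_Comp1 _ _ _ _ (head 0 v)) => //; case: v.
- exists (Comp Succ [:: Comp o [:: Proj 1; Proj 0]]) => w v.
  apply: (@run_Comp1 _ _ _ _ (O w (head 0 v))) => //.
  by apply: run_Comp2 (run_o w (head 0 v)) => //; case: v.
- by move=> i; exists (Comp Succ [:: Proj i.+1]) => w v; apply: (@run_Comp1 _ _ _ _ (nth 0 v i)).
- have [qs' Hqs'] : exists qs', forall w v,
      run_all f (w :: v) qs' [seq eval (O w) w q v | q <- qs].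
    elim: qs IHqs => [_|q qs IH [[q' Hq'] /IH[qs' Hqs']]]; first by exists [::].
    by exists (q' :: qs') => w v; split; [exact: Hq'|exact: Hqs'].
  pose prod := foldr (fun q r => Comp prog_mul [:: q; r]) (prog_const 1) qs'.
  exists (Comp prog_mul [:: Comp prog_pos [:: prod];
    Comp h' (Proj 0 :: [seq Comp prog_pred [:: q] | q <- qs'])]) => w v.
  apply: run_Comp2 _ _ (run_mul _ _ _).
    apply: run_Comp1 (run_pos _ _).
    have := Hqs' w v; rewrite /prod.
    elim: qs' [seq eval _ _ _ _ | _ <- _] {Hqs' prod} => [|q qs' IH] [|r rs] //=.
      by move=> _; rewrite big_nil; exact: (run_const f 1).
    move=> [qr /IH rrs]; rewrite big_cons; exact: run_Comp2 qr rrs (run_mul _ _ _).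
  exists (w :: map predn [seq eval (O w) w q v | q <- qs]); last exact: IHh.
  split=> //; have := Hqs' w v.
  elim: qs' [seq eval _ _ _ _ | _ <- _] {Hqs' prod} => [|q qs' IH] [|r rs] //=.
  by move=> [qr /IH rrs]; split=> //; exact: run_Comp1 qr (run_pred _ _).
- have [Nb extb] := eval_ext b; have [Ns exts] := eval_ext s.
  (* The first [N] arguments are passed on one by one, as [eval_ext] permits. Inside the recursion
     the order is counter, value, [w], arguments, whereas [s'] expects [w] first. *)
  pose N := maxn Nb Ns.
  exists (Comp (PrimRec b' (Comp prog_mul [:: Comp prog_pos [:: Proj 1];
     Comp s' ([:: Proj 2; Proj 0; Comp prog_pred [:: Proj 1]] ++ [seq Proj i | i <- iota 3 N])]))
    ([:: Proj 1; Proj 0] ++ [seq Proj i | i <- iota 2 N])) => w v.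
  pose u := [seq nth 0 (w :: v) i | i <- iota 2 N].
  exists [:: head 0 v, w & u].
    by split; [case: v @u|split=> //; exact: run_all_Proj].
  have nth_u i : i < N -> nth 0 u i = nth 0 (behead v) i.
    by move=> iN; rewrite nth_map_iota// nth_behead.
  rewrite [X in run _ _ _ X]/=; elim: (head 0 v) => [|k IHk].
    apply: run_PrimRec0; rewrite [X in run _ _ _ X]/= (@extb _ u); first exact: IHb.
    by move=> i iN; rewrite nth_u// leq_max iN.
  apply: run_PrimRecS IHk _; rewrite iteriS; set r := iteri k _ _.
  apply: run_Comp2 _ _ (run_mul _ _ _).
    by apply: (@run_Comp1 _ _ _ _ r) => //; exact: run_pos.
  pose u' := [seq nth 0 [:: k, r, w & u] i | i <- iota 3 N].
  exists [:: w, k, r.-1 & u'].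
    do 2 split=> //; split; first by apply: (@run_Comp1 _ _ _ _ r) => //; exact: run_pred.
    exact: run_all_Proj.
  rewrite (@exts _ [:: k, r.-1 & u']); first exact: IHs.
  move=> -[|[|i]] // iN; have iN' : i < N by rewrite leq_max; apply/orP; right; lia.
  by rewrite [LHS]/= [RHS]/= nth_map_iota// -[RHS]/(nth 0 u i) nth_u.
- have [N ext] := eval_ext q.
  (* The product first vanishes where [eval] is at most 1, and at [w] at the latest. So this
     minimization halts and agrees with [find], which returns [w] on failure. *)
  pose search := Comp prog_mul [:: Comp prog_pred
    [:: Comp q' ([:: Proj 1; Proj 0] ++ [seq Proj i | i <- iota 2 N])];
    Comp prog_sub [:: Proj 1; Proj 0]].
  have run_search w v y : run f search [:: y, w & v] ((eval (O w) w q (y :: v)).-1 * (w - y)).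
    apply: run_Comp2 _ _ (run_mul _ _ _); last first.
      by apply: run_Comp2 (run_sub _ w y).
    apply: run_Comp1 (run_pred _ _).
    pose u := [seq nth 0 [:: y, w & v] i | i <- iota 2 N].
    exists [:: w, y & u]; first by do 2 split=> //; exact: run_all_Proj.
    rewrite (@ext _ (y :: u)); first exact: IHq.
    by move=> -[|i] //= iN; rewrite nth_map_iota//; lia.
  pose val := Comp q' ([:: Proj 1; Proj 0] ++ [seq Proj i | i <- iota 2 N]).
  exists (Comp (Comp prog_mul [:: Comp prog_mul [:: Comp prog_pos [:: val];
      Comp prog_sub [:: prog_const 1; Comp prog_pred [:: val]]]; Succ])
    ([:: Mu search; Proj 0] ++ [seq Proj i | i <- iota 1 N])) => w v.
  rewrite [X in run _ _ _ X]/=; set y := find _ _.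
  pose u := [seq nth 0 (w :: v) i | i <- iota 1 N].
  have nth_u i : i < N -> nth 0 u i = nth 0 v i by move=> iN; rewrite nth_map_iota.
  exists [:: y, w & u].
    split; last by split=> //; exact: run_all_Proj.
    split.
      rewrite (_ : 0 = (eval (O w) w q (y :: v)).-1 * (w - y)); first exact: run_search.
      case: (ltnP y w) => [yw|]; last by rewrite -subn_eq0 => /eqP ->; rewrite muln0.
      have : has (fun y => eval (O w) w q (y :: v) <= 1) (iota 0 w).
        by rewrite has_find size_iota.
      move=> /(nth_find 0); rewrite -/y nth_iota// add0n.
      by case: eval => [|[]].
    move=> z zy; have zw : z < w.
      by rewrite (leq_trans zy)// -[X in _ <= X](size_iota 0) find_size.
    exists ((eval (O w) w q (z :: v)).-1 * (w - z)).-1.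
    rewrite prednK; first exact: run_search.
    by move/find_iota_before: zy; rewrite -ltnNge muln_gt0 subn_gt0 zw andbT; case: eval => [|[]].
  have run_val : run f val [:: y, w & u] (eval (O w) w q (y :: v)).
    pose u' := [seq nth 0 [:: y, w & u] i | i <- iota 2 N].
    exists [:: w, y & u']; first by do 2 split=> //; exact: run_all_Proj.
    rewrite (@ext _ (y :: u')); first exact: IHq.
    move=> -[|i] //= iN; have iN' : i < N by lia.
    by rewrite nth_map_iota// -[RHS]/(nth 0 u i) nth_u.
  rewrite (_ : _ == 1 = (0 < eval (O w) w q (y :: v)) * (1 - (eval (O w) w q (y :: v)).-1) :> nat);
    last by case: eval => [|[]].
  apply: run_Comp2 _ _ (run_mul _ _ _) => //.
  apply: run_Comp2 _ _ (run_mul _ _ _); first exact: run_Comp1 run_val (run_pos _ _).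
  by apply: run_Comp2 (run_const _ _ _) _ (run_sub _ _ _); exact: run_Comp1 run_val (run_pred _ _).
Qed.

End EvalProgram.

(** * Enumeration of programs through finite trees, and diagonalization *)

Fixpoint program_tree (p : program) : GenTree.tree nat :=
  match p with
  | Zero => GenTree.Node 0 [::]
  | Succ => GenTree.Node 1 [::]
  | Query => GenTree.Node 2 [::]
  | Proj i => GenTree.Leaf i
  | Comp h qs => GenTree.Node 3 (program_tree h :: map program_tree qs)
  | PrimRec b s => GenTree.Node 4 [:: program_tree b; program_tree s]
  | Mu q => GenTree.Node 5 [:: program_tree q]
  end.

Fixpoint tree_program (t : GenTree.tree nat) : program :=
  match t with
  | GenTree.Leaf i => Proj i
  | GenTree.Node n ts =>
      match n, map tree_program ts with
      | 1, _ => Succ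
      | 2, _ => Query
      | 3, h :: qs => Comp h qs
      | 4, [:: b; s] => PrimRec b s
      | 5, [:: q] => Mu q
      | _, _ => Zero
      end
  end.

Lemma program_treeK : cancel program_tree tree_program.
Proof.
elim/program_nested_ind => //= [h qs -> IHqs|b s -> ->//|q ->//].
by congr Comp; elim: qs IHqs => //= q qs IH [-> /IH ->].
Qed.

Definition program_of_nat (k : nat) : program :=
  if unpickle k is Some t then tree_program t else Zero.

Lemma program_of_nat_surj p : exists k, program_of_nat k = p.
Proof.
by exists (pickle (program_tree p)); rewrite /program_of_nat pickleK program_treeK.
Qed.

(** By diagonalization: [h k] differs from the output, if any, of the [k]-th program at [k]. *)
Lemma exists_not_turing_le f : exists h, ~ turing_le h f.
Proof.
have [|h Hh] := @boolp.choice nat nat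
    (fun k x => forall y, run f (program_of_nat k) [:: k] y -> x <> y).
  move=> k.
  have [[y ry]|nr] := pselect (exists y, run f (program_of_nat k) [:: k] y).
    exists y.+1 => y' ry'; rewrite (run_det ry' ry); lia.
  by exists 0 => y ry; case: nr; exists y.
exists h => -[p]; have [k <-] := program_of_nat_surj p => /(_ k) /Hh; exact.
Qed.

(** * A uniformly computable dense sequence of oracles *)

Definition root (w : nat) : nat := find (fun m => w < m.+1 * m.+1) (iota 0 w.+1).

Lemma rootE w m : m * m <= w -> w < m.+1 * m.+1 -> root w = m.
Proof. by move=> mw wm; apply: find_iotaE => // [|z zm]; nia. Qed.

(* The digits of [w] are the remainders met while iterating the integer square
   root; every finite sequence is the beginning of such an expansion. *)
Definition digit (w n : nat) : nat :=
  let z := iter n root w in z - root z * root z.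

(** Digits are prepended: when [x 0 <= w], the number [w * w + x 0] has root [w] and remainder
    [x 0]. The bound [L] ensures this inequality in the induction, and later makes [w] a sufficient
    search bound. *)
Lemma digit_dense (x : nat -> nat) m L :
  exists2 w, L <= w & forall i, i < m -> digit w i = x i.
Proof.
elim: m x L => [|m IH] x L; first by exists L.
have [w wL Hw] := IH (stail x) (maxn L (x 0)).
have root_w : root (w * w + x 0) = w by apply: rootE; nia.
exists (w * w + x 0); first by nia.
by move=> [|i] im; rewrite /digit ?iterSr root_w; [exact: addKn|exact: Hw].
Qed.

Definition prog_root :=
  Mu (Comp prog_sub [:: Comp Succ [:: Proj 1]; Comp prog_mul [:: Succ; Succ]]).

Lemma run_root g w : run g prog_root [:: w] (root w).
Proof.
have step m : run g (Comp prog_sub [:: Comp Succ [:: Proj 1]; Comp prog_mul [:: Succ; Succ]])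
    [:: m; w] (w.+1 - m.+1 * m.+1).
  apply: run_Comp2 _ _ (run_sub _ _ _); first by apply: (@run_Comp1 _ _ _ _ w).
  by apply: run_Comp2 _ _ (run_mul _ _ _).
split=> [|z].
- have /(nth_find 0) : has (fun m => w < m.+1 * m.+1) (iota 0 w.+1).
    by apply/hasP; exists w; rewrite ?mem_iota//=; lia.
  have lt : root w < w.+1.
    by rewrite ltnS leqNgt; apply/negP => /find_iota_before; rewrite -leqNgt; lia.
  rewrite -/(root w) nth_iota// add0n; rewrite -subn_eq0 => /eqP E.
  by have := step (root w); rewrite E.
- move=> /find_iota_before; rewrite -leqNgt => zw.
  exists (w.+1 - z.+1 * z.+1).-1; rewrite prednK; first exact: step.
  by rewrite subn_gt0.
Qed.

Definition prog_digit :=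
  Comp (Comp prog_sub [:: Proj 0; Comp prog_mul [:: prog_root; prog_root]])
       [:: PrimRec (Proj 0) (Comp prog_root [:: Proj 1])].

Lemma run_digit g w n : run g prog_digit [:: n; w] (digit w n).
Proof.
apply: (@run_Comp1 _ _ _ _ (iter n root w)).
  elim: n => [|n IH]; first exact: run_PrimRec0.
  by apply: run_PrimRecS IH _; apply: (@run_Comp1 _ _ _ _ (iter n root w)) => //; exact: run_root.
apply: run_Comp2 _ _ (run_sub _ _ _) => //.
exact: run_Comp2 (run_root _ _) (run_root _ _) (run_mul _ _ _).
Qed.

Definition splice (x : nat -> nat) (m : nat) (h : nat -> nat) : nat -> nat :=
  fun i => if i < m then x i else h (i - m).

(** Only [m] values of [x] enter, and they are built into the program; [x] may be noncomputable. *)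
Lemma functional_splice x m : exists p, forall h, functional p h (splice x m h).
Proof.
elim: m x => [|m IH] x.
  exists Query => h; rewrite (_ : splice x 0 h = h)//.
  by apply/funext => i; rewrite /splice ltn0 subn0.
have [p Hp] := IH (stail x); exists (prog_cons (x 0) p) => h.
rewrite (_ : splice x m.+1 h = scons (x 0) (splice (stail x) m h)).
  exact: functional_cons.
by apply/funext => -[|i]; rewrite /splice.
Qed.

Lemma turing_le_splice x m h : turing_le h (splice x m h).
Proof.
exists (Comp Query [:: Comp prog_add [:: Proj 0; prog_const m]]) => i.
apply: (@run_Comp1 _ _ _ _ (i + m)).
  by apply: (@run_Comp2 _ _ _ _ _ i m) (run_const _ _ _) (run_add _ _ _).
by rewrite /= /splice ltnNge leq_addl addnK.
Qed.

Lemma join_agree f h h' m : (forall i, i < m -> h' i = h i) ->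
  forall i, i < m -> join f h' i = join f h i.
Proof.
by move=> ag i im; rewrite /join; case: odd => //; apply: ag; lia.
Qed.

(* [e n] is found by searching, among the [f]-computable oracles [digit w], for
   a halting computation: its output is also the output for every [h] that is
   not computable in [f] and extends the finite part of [digit w] which it uses. *)
Lemma cone_avoidance f e p :
  (forall h, ~ turing_le h f -> functional p (join f h) e) -> turing_le e f.
Proof.
move=> pe; have [h hf] := exists_not_turing_le f.
pose o := Comp prog_add
  [:: Comp prog_mul [:: Comp prog_odd [:: Proj 0];
                        Comp prog_digit [:: Comp prog_half [:: Proj 0]; Proj 1]];
      Comp prog_mul [:: Comp prog_sub [:: prog_const 1; Comp prog_odd [:: Proj 0]];
                        Comp Query [:: Comp prog_half [:: Proj 0]]]].
have run_o w n : run f o [:: n; w] (join f (digit w) n).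
  have r0 : run f (Proj 0) [:: n; w] n by [].
  have r1 := run_Comp1 r0 (run_odd _ _); have r2 := run_Comp1 r0 (run_half _ _).
  have -> : join f (digit w) n = odd n * digit w n./2 + (1 - odd n) * f n./2.
    by rewrite /join; case: odd; rewrite ?mul0n ?mul1n ?addn0 ?add0n.
  apply: run_Comp2 (run_add _ _ _); apply: run_Comp2 _ _ (run_mul _ _ _).
  - exact: r1.
  - exact: run_Comp2 r2 _ (run_digit _ _ _).
  - exact: run_Comp2 (run_const _ _ _) r1 (run_sub _ _ _).
  - by apply: run_Comp1 r2 _.
have [p' Hp'] := eval_program run_o p.
have sound w n y : eval (join f (digit w)) w p [:: n] = y.+1 -> y = e n.
  move=> /eval_sound ry; have [m Hm] := run_continuous ry.
  have /pe/(_ n) : ~ turing_le (splice (digit w) m h) f.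
    by move=> /(turing_le_trans (turing_le_splice _ _ _)).
  apply: run_det; apply: Hm; apply: join_agree => i im.
  by rewrite /splice im.
have complete n : exists w, 0 < eval (join f (digit w)) w p [:: n].
  have [m Hm] := eval_complete (pe h hf n).
  (* This [w] exceeds the modulus [m] as a search bound and imitates [h] below [m] as an oracle. *)
  have [w mw Hw] := digit_dense h m m.
  by exists w; rewrite Hm//; exact: join_agree.
exists (Comp prog_pred [:: Comp p'
  [:: Mu (Comp prog_sub [:: prog_const 1; Comp p' [:: Proj 0; Proj 1]]); Proj 0]]) => n.
case: (ex_minnP (complete n)) => w w_gt0 w_min.
have -> : e n = (eval (join f (digit w)) w p [:: n]).-1.
  by apply/esym/(@sound w); rewrite prednK.
apply: run_Comp1 (run_pred _ _); apply: (@run_Comp2 _ _ _ _ _ w n) => //.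
have step z : run f (Comp prog_sub [:: prog_const 1; Comp p' [:: Proj 0; Proj 1]])
    [:: z; n] (1 - eval (join f (digit z)) z p [:: n]).
  by apply: run_Comp2 (run_const _ _ _) _ (run_sub _ _ _); apply: run_Comp2 (Hp' z [:: n]).
split=> [|z zw].
  by have := step w; rewrite (_ : 1 - _ = 0)//; lia.
exists 0; have := step z; rewrite (_ : eval _ _ _ _ = 0)//.
by apply/eqP; rewrite -leqn0 leqNgt; apply/negP => /w_min; lia.
Qed.

(** * Perfect independent families *)

Section PerfectFamily.
(* [G i] is the graph of a partial continuous map on Baire space, given
   coordinatewise: [G i x n v] says that the [n]-th value at [x] is [v]. *)
Variable G : nat -> (nat -> nat) -> nat -> nat -> Prop.
Hypothesis G_det : forall i x n v v', G i x n v -> G i x n v' -> v = v'.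
Hypothesis G_cont : forall i x n v, G i x n v ->
  exists m, forall x', (forall j, j < m -> x' j = x j) -> G i x' n v.

Definition extends (x : nat -> nat) (s : seq nat) :=
  forall j, j < size s -> x j = nth 0 s j.

Definition avoids i (s t : seq nat) := forall x y, extends x s -> extends y t ->
  ~ forall n, G i x n (y n).

Lemma extends_prefix x s s' : prefix s s' -> extends x s' -> extends x s.
Proof.
move=> /prefixP[u ->] ext j js; rewrite ext ?nth_cat ?js// size_cat.
exact: leq_trans js (leq_addr _ _).
Qed.

Lemma avoids_prefix i s s' t t' :
  prefix s s' -> prefix t t' -> avoids i s t -> avoids i s' t'.
Proof. by move=> ss' tt' av x y /(extends_prefix ss') xs /(extends_prefix tt'); exact: av. Qed.

(** If some [x] extending [s] has a value [v] at position [size t], freeze the part of [x] that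
    decides it and append [v.+1] to [t]. Otherwise [s] and [t] already avoid each other. *)
Lemma extend_to_avoid i (s t : seq nat) :
  exists s' t', [/\ prefix s s', prefix t t' & avoids i s' t'].
Proof.
have [[x [v [xs Gx]]]|noG] :=
    pselect (exists x v, extends x s /\ G i x (size t) v); last first.
  exists s, t; split=> [||x y xs yt Gxy]; rewrite ?prefix_refl//.
  by apply: noG; exists x, (y (size t)).
have [m Hm] := G_cont Gx.
exists (mkseq x (size s + m)), (rcons t v.+1); split; rewrite ?prefix_rcons//.
- apply/prefixP; exists (mkseq (fun j => x (size s + j)) m).
  apply: (@eq_from_nth _ 0) => [|j]; first by rewrite size_cat !size_mkseq.
  rewrite size_mkseq => jsm.
  rewrite nth_mkseq// nth_cat; case: ltnP => js; first exact: xs.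
  by rewrite nth_mkseq ?subnKC// ltn_subLR.
- move=> x' y ext_x' ext_y Gxy.
  have := Gxy (size t); rewrite (ext_y (size t)) ?size_rcons// nth_rcons ltnn eqxx.
  suff Gx' : G i x' (size t) v by move=> /(G_det Gx'); lia.
  by apply: Hm => j jm; rewrite ext_x' ?size_mkseq ?nth_mkseq//; lia.
Qed.

(** The requirements are met one at a time; those met earlier survive further extension. *)
Lemma extend_all_to_avoid (T : eqType) (s : T -> seq nat) (L : seq (nat * (T * T))) :
  exists s', (forall t, prefix (s t) (s' t)) /\
    (forall i a b, (i, (a, b)) \in L -> a != b -> avoids i (s' a) (s' b)).
Proof.
elim: L => [|[i [a b]] L [s' [ss' avL]]]; first by exists s; split=> // t; rewrite prefix_refl.
have [ab|ab] := eqVneq a b.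
  exists s'; split=> // j c d; rewrite inE => /predU1P[[_ -> ->]|]; last exact: avL.
  by rewrite ab eqxx.
have [sa [sb [pa pb av]]] := extend_to_avoid i (s' a) (s' b).
pose s'' t := if t == a then sa else if t == b then sb else s' t.
have s's'' t : prefix (s' t) (s'' t).
  rewrite /s''; case: eqVneq => [->//|_]; case: eqVneq => [->//|_].
  exact: prefix_refl.
exists s''; split=> [t|j c d]; first exact: prefix_trans (ss' t) (s's'' t).
rewrite inE => /predU1P[[-> -> ->] _|/avL av' cd].
  by rewrite /s'' !eqxx eq_sym (negbTE ab).
exact: avoids_prefix (s's'' _) (s's'' _) (av' cd).
Qed.

(** One level of a fusion tree, with finitely many requirements. The appended 0 forces nodes to
    grow, so that branches are total functions. *)
Lemma fusion_step k (s : seq bool -> seq nat) : exists s' : seq bool -> seq nat,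
  (forall t, prefix (rcons (s (take k t)) 0) (s' t)) /\
  (forall i a b, i <= k -> size a = k.+1 -> size b = k.+1 -> a != b ->
     avoids i (s' a) (s' b)).
Proof.
pose strings := [seq val t | t <- enum {: k.+1.-tuple bool}].
have mem_strings a : size a = k.+1 -> a \in strings.
  by move=> /eqP sa; apply/mapP; exists (Tuple sa); rewrite ?mem_enum.
pose pairs := [seq (a, b) | a <- strings, b <- strings].
have [s' [ss' av]] := extend_all_to_avoid (fun t => rcons (s (take k t)) 0)
  [seq (i, ab) | i <- iota 0 k.+1, ab <- pairs].
exists s'; split=> // i a b ik sa sb; apply: av.
apply/allpairsP; exists (i, (a, b)); split=> //; first by rewrite mem_iota.
by apply/allpairsP; exists (a, b); split=> //; exact: mem_strings.
Qed.

Lemma perfect_family : exists h : (nat -> bool) -> (nat -> nat),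
  forall i a b, a <> b -> ~ forall n, G i (h a) n (h b n).
Proof.
have [next Hnext] := boolp.choice (fun ks : nat * (seq bool -> seq nat) => fusion_step ks.1 ks.2).
pose s := fix s k := if k is k'.+1 then next (k', s k') else fun=> [::].
pose node (a : nat -> bool) k := s k (mkseq a k).
have node_prefix a k : prefix (rcons (node a k) 0) (node a k.+1).
  have := (Hnext (k, s k)).1 (mkseq a k.+1).
  by rewrite /= (_ : take k _ = mkseq a k)// /mkseq -map_take take_iota (minn_idPl _).
have size_node a k : k <= size (node a k).
  elim: k => // k IH; have /prefixP[u ->] := node_prefix a k.
  by rewrite size_cat size_rcons; lia.
(* The node at level [n.+1] has more than [n] entries, so the default is not read. *)
pose h (a : nat -> bool) n := nth 0 (node a n.+1) n.
have node_mono a k l : k <= l -> prefix (node a k) (node a l).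
  elim: l => [|l IH]; first by rewrite leqn0 => /eqP ->; rewrite prefix_refl.
  rewrite leq_eqVlt => /predU1P[->|/IH kl]; first by rewrite prefix_refl.
  by apply: prefix_trans kl (prefix_trans _ (node_prefix a l)); exact: prefix_rcons.
have h_ext a k : extends (h a) (node a k).
  move=> j jk; rewrite /h; case: (leqP k j.+1) => [kj|/ltnW jk'].
    by have /prefixP[u ->] := node_mono a _ _ kj; rewrite nth_cat jk.
  have /prefixP[u ->] := node_mono a _ _ jk'.
  by rewrite nth_cat size_node.
exists h => i a b ab.
have [n abn] : exists n, a n <> b n.
  by apply: contrapT => nab; apply: ab; apply/funext => n; apply: contrapT => abn; apply: nab; exists n.
(* Level [k.+1] treats [i] because [i <= k], and separates [a] from [b] because [n <= k]. *)
pose k := maxn i n; apply: ((Hnext (k, s k)).2 i (mkseq a k.+1) (mkseq b k.+1)).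
- by rewrite leq_maxl.
- by rewrite size_mkseq.
- by rewrite size_mkseq.
- apply/eqP => /(congr1 (fun t => nth false t n)).
  by rewrite !nth_mkseq// ltnS leq_maxr.
- exact: (h_ext a k.+1).
- exact: (h_ext b k.+1).
Qed.

End PerfectFamily.

(** * Finite meets *)

(** With [n] and [F] fixed, tags do not change with [S], so a smaller [S] gives a subset. *)
Definition finite_meet (B : mass_problem) n (F : 'I_n -> nat -> nat) (S : {set 'I_n}) :
  mass_problem :=
  [set y | (y 0 = 0 /\ B (stail y)) \/ exists2 i, i \in S & y = scons i.+1 (F i)].

Lemma medvedev_le_cons n X : medvedev_le [set y | y 0 = n /\ X (stail y)] X.
Proof.
apply/medvedev_leP; exists (prog_cons n Query) => x Xx.
by exists (scons n x); [split|exact: functional_cons (functional_id _)].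
Qed.

Lemma medvedev_le_tail (X : mass_problem) : medvedev_le X [set y | X (stail y)].
Proof.
by apply/medvedev_leP; exists prog_tail => y Xy; exists (stail y) => //; exact: functional_tail.
Qed.

Lemma finite_meet_le B n (F : 'I_n -> nat -> nat) S : medvedev_le (finite_meet B F S) B.
Proof. by apply: medvedev_le_trans (medvedev_le_cons 0 B); apply: medvedev_le_sub => y; left. Qed.

Lemma finite_meet_le1 B n (F : 'I_n -> nat -> nat) (S : {set 'I_n}) i :
  i \in S -> medvedev_le (finite_meet B F S) [set F i].
Proof.
move=> iS; apply: medvedev_le_trans (medvedev_le_cons i.+1 [set F i]).
by apply: medvedev_le_sub => y [y0 yF]; right; exists i => //; rewrite -yF -y0 scons_stail.
Qed.

(** The universal property of the greatest lower bound: the tag [y 0] tells which reduction to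
    use. *)
Lemma le_finite_meet B n (F : 'I_n -> nat -> nat) (S : {set 'I_n}) X :
  medvedev_le X B -> (forall i, i \in S -> medvedev_le X [set F i]) ->
  medvedev_le X (finite_meet B F S).
Proof.
move=> XB XF; apply: (@medvedev_le_cases _ _ Query n.+1).
  by move=> y [[y0 _]|[i _ ->]]; [exists 0|exists i.+1 => //; rewrite ltnS].
move=> [_|j jn].
- apply: medvedev_le_trans XB (medvedev_le_trans (medvedev_le_tail B) _).
  by apply: medvedev_le_sub => y [[[]//|[i _ ->]]].
(* For [j] outside [S] no point carries the tag [j.+1], and the case is empty. *)
- have [jS|jS] := boolP (Ordinal (jn : j < n) \in S); last first.
    apply: medvedev_le_trans XB (medvedev_le_sub _) => y [[[y0 _]|[i iS ->]]].
      by rewrite /= y0.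
    move=> [] /= ij; move: iS jS; rewrite (_ : Ordinal _ = i) => [->//|].
    exact/val_inj.
  apply: medvedev_le_trans (XF _ jS) (medvedev_le_trans (medvedev_le_tail _) _).
  apply: medvedev_le_sub => y [[[y0 _]|[i iS ->]]]; first by rewrite /= y0.
  by move=> [ij] /=; congr F; apply/val_inj.
Qed.

Lemma finite_meet_mono B n (F : 'I_n -> nat -> nat) (S T : {set 'I_n}) :
  S \subset T -> medvedev_le (finite_meet B F T) (finite_meet B F S).
Proof.
by move=> /fintype.subsetP ST; apply: medvedev_le_sub => y [?|[i /ST iT ->]]; [left|right; exists i].
Qed.

(** * Large antichains *)

Section Antichain.
(** [A0] will be either [A] itself or the strict cone above a point of [A]. *)
Variables A B A0 : mass_problem.
Hypothesis A_le_A0 : medvedev_le A A0.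
Hypothesis A_le_B : medvedev_le A B.
Hypothesis no_finite_meet : forall n (F : 'I_n -> nat -> nat) (S : {set 'I_n}),
  (forall i, i \in S -> A0 (F i)) -> ~ medvedev_le (finite_meet B F S) A0.

Let zero : nat -> nat := fun=> 0.
Let prog := program_of_nat.

(** The zero half leaves room to place an independent function beyond any finite use. *)
Definition point (st : nat * (nat -> nat)) : nat -> nat :=
  scons st.1.+1 (join st.2 zero).

(** The output of a program at the point of its own stage can then lie neither in the copy of [B],
    nor at an earlier point (third clause), nor carry a later tag (second clause). *)
Definition stage_ok (l : seq (nat * (nat -> nat))) (st : nat * (nat -> nat)) : Prop :=
  [/\ A0 st.2,
      forall i, i < size l -> st.1 <> (nth (0, zero) l i).1 /\
        forall y, functional (prog i) (point (nth (0, zero) l i)) y -> y 0 <> st.1.+1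
    & forall y, functional (prog (size l)) (point st) y ->
        ~ (y 0 = 0 /\ B (stail y)) /\
        forall i, i < size l -> y <> point (nth (0, zero) l i)].

Lemma uniform_bound (Q : nat -> nat -> Prop) k :
  (forall i, exists m, forall m', m <= m' -> Q i m') ->
  exists M, forall i, i < k -> Q i M.
Proof.
move=> HQ; suff [M HM] : exists M, forall M' i, M <= M' -> i < k -> Q i M'.
  by exists M => i; exact: HM.
elim: k => [|k [M HM]]; first by exists 0.
have [m Hm] := HQ k; exists (maxn M m) => M' i; rewrite geq_max => /andP[MM mM].
by rewrite ltnS leq_eqVlt => /predU1P[->|ik]; [exact: Hm|exact: HM].
Qed.

(** Take a tag [M] above all the forbidden ones. If no [f] in [A0] were suitable, the current
    program would reduce a finite meet of [B] with the earlier points to [A0]. *)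
Lemma stage_exists (l : seq (nat * (nat -> nat))) :
  uniq (map fst l) -> (forall i, i < size l -> A0 (nth (0, zero) l i).2) ->
  exists st, stage_ok l st.
Proof.
move=> l_uniq lA.
have [M HM] : exists M, forall i, i < size l -> (nth (0, zero) l i).1 < M /\
    forall y, functional (prog i) (point (nth (0, zero) l i)) y -> y 0 <> M.+1.
  apply: uniform_bound => i.
  have [[y fy]|nfy] := pselect (exists y, functional (prog i) (point (nth (0, zero) l i)) y).
    exists (maxn (nth (0, zero) l i).1.+1 (y 0)) => m'; rewrite geq_max => /andP[lm ym].
    by split=> // y' fy'; rewrite (functional_unique fy' fy); lia.
  by exists (nth (0, zero) l i).1.+1 => m' lm; split=> // y fy; case: nfy; exists y.
apply: contrapT => noM.
have fail f : A0 f -> exists2 y, (y 0 = 0 /\ B (stail y)) \/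
    (exists2 i, i < size l & y = point (nth (0, zero) l i)) &
    functional (prog (size l)) (point (M, f)) y.
  move=> Af; apply: contrapT => nfail; apply: noM; exists (M, f); split=> //=.
    by move=> i /HM[lt ne]; split=> //; lia.
  move=> y fy; split=> [By|i il yi]; apply: nfail; exists y => //; first by left.
  by right; exists i.
pose tags := map fst l.
pose F (j : 'I_M) := (nth (0, zero) l (index (j : nat) tags)).2.
pose S := [set j : 'I_M | (j : nat) \in tags]%SET.
apply: (@no_finite_meet M F S).
  by move=> j; rewrite inE => jt; apply: lA; rewrite -(size_map fst) index_mem.
(* [Z] is the meet with the zero halves still present; deleting them leads to the finite meet. Tags
   are distinct, so [index] recovers the stage. *)
pose Z : mass_problem := [set y | (y 0 = 0 /\ B (stail y)) \/
    (exists2 i, i < size l & y = point (nth (0, zero) l i))].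
apply: (@medvedev_le_trans _ Z); last first.
  apply/medvedev_leP.
  exists (oracle_subst (prog_cons M.+1 (prog_join Query Zero)) (prog (size l))).
  move=> f /fail[y Zy fy]; exists y => //; apply: functional_comp fy.
  by apply: functional_cons; apply: functional_join.
apply: (@medvedev_le_cases _ _ Query M.+1) => [y [[y0 _]|[i /HM[lt _] ->]]|[_|j jM]].
- by exists 0.
- by exists (nth (0, zero) l i).1.+1.
- apply: medvedev_le_sub => y [[By _|[i il ->]]]; first by left.
  by [].
- apply/medvedev_leP; exists (prog_cons j.+1 (oracle_subst prog_tail prog_left)).
  move=> y [[[y0 _]|[i il ->]]]; first by rewrite /= y0.
  move=> /= -[ji].
  have ji' : index j tags = i.
    by rewrite ji -(nth_map _ 0)// index_uniq// size_map.
  exists (scons j.+1 (nth (0, zero) l i).2); last first.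
    by apply: functional_cons; apply: functional_comp (functional_tail _) (functional_left _ _).
  right; exists (Ordinal (jM : j < M)); last by rewrite /F /= ji'.
  by rewrite inE /= -index_mem ji' size_map.
Qed.

Lemma stages : exists st : nat -> nat * (nat -> nat), forall k,
  stage_ok (mkseq st k) (st k).
Proof.
have [|next Hnext] := @boolp.choice (seq (nat * (nat -> nat))) _ (fun l st =>
    uniq (map fst l) -> (forall i, i < size l -> A0 (nth (0, zero) l i).2) -> stage_ok l st).
  move=> l; have [[H1 H2]|nH] := pselect (uniq (map fst l) /\
      forall i, i < size l -> A0 (nth (0, zero) l i).2).
    by have [st Hst] := stage_exists H1 H2; exists st.
  (* A default for invalid histories, which [valid] excludes. *)
  by exists (0, zero) => H1 H2; case: nH.
pose L := fix L k := if k is k'.+1 then rcons (L k') (next (L k')) else [::].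
pose st k := next (L k).
have LE k : L k = mkseq st k by elim: k => //= k IH; rewrite mkseqS -IH.
suff valid k : uniq (map fst (L k)) /\ forall i, i < size (L k) -> A0 (nth (0, zero) (L k) i).2.
  by exists st => k; rewrite -LE; apply: Hnext; case: (valid k).
elim: k => [|k [uL AL]] /=; first by split.
have [Ast fresh _] := Hnext _ uL AL; split.
  rewrite map_rcons rcons_uniq uL andbT; apply/negP => /(nthP 0)[i].
  rewrite size_map => iL; rewrite (nth_map (0, zero))// => e.
  by have [+ _] := fresh i iL; rewrite e.
move=> i; rewrite size_rcons ltnS leq_eqVlt nth_rcons => /predU1P[->|iL].
  by rewrite ltnn eqxx.
by rewrite iL; exact: AL.
Qed.

Definition marker (u : nat) (x : nat -> nat) : nat -> nat := splice zero u (scons 1 x).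

Lemma marker_agree u m x x' : (forall i, i < m -> x' i = x i) ->
  forall i, i < m -> marker u x' i = marker u x i.
Proof.
move=> ag i im; rewrite /marker /splice; case: ltnP => // ui.
by case E: (i - u) => [//|j] /=; apply: ag; lia.
Qed.

Lemma scons_agree n m x x' : (forall i, i < m -> x' i = x i) ->
  forall i, i < m -> scons n x' i = scons n x i.
Proof. by move=> ag [|i] //= im; apply: ag; exact: ltnW. Qed.

Lemma marker_last u x m : marker u x (u.+1 + m) = x m.
Proof. by rewrite /marker /splice ltnNge addSn ltnW ?ltnS ?leq_addr// -addnS addKn. Qed.

Lemma incomparable_family : exists X : set (nat -> bool) -> mass_problem,
  (forall I, medvedev_le A (X I) /\ medvedev_le (X I) B) /\
  (forall I J a, J a -> ~ I a -> ~ medvedev_le (X I) (X J)).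
Proof.
have [st Hst] := stages.
(* The flag [b] chooses between the point of stage [k] with [x] placed behind [u] zeros and the bare
   point. The last component is the marker length expected in the output. *)
pose oracle (c : bool * nat * nat * nat) (x : nat -> nat) :=
  let: (b, k, u, _) := c in
  if b then scons (st k).1.+1 (join (st k).2 (marker u x)) else point (st k).
(* Entry [m] behind a marker of length [u'] sits at [u'.+1 + m], hence at twice this plus 1 in the
   join and plus 2 after the tag. *)
pose G i x m v := if unpickle i is Some c then
  let: (_, k, _, u') := (c : bool * nat * nat * nat) in
  run (oracle c x) (prog k) [:: ((u'.+1 + m) + (u'.+1 + m)).+2] v else False.
have G_det i x m v v' : G i x m v -> G i x m v' -> v = v'.
  by rewrite /G; case: unpickle => // -[[[b k] u] u']; exact: run_det.
have G_cont i x m v : G i x m v ->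
    exists M, forall x', (forall j, j < M -> x' j = x j) -> G i x' m v.
  rewrite /G; case: unpickle => // -[[[b k] u] u'] /run_continuous[M HM].
  exists M => x' ag; apply: HM => j jM; rewrite /oracle; case: b => //.
  by apply: scons_agree jM; apply: join_agree; exact: marker_agree.
have [h Hh] := perfect_family G_det G_cont.
have no_marker t k u u' a b g y : a <> b ->
    functional (prog k) (oracle (t, k, u, u') (h a)) y ->
    stail y <> join g (marker u' (h b)).
  move=> ab fy ey; apply: (Hh (pickle (t, k, u, u')) a b ab) => m.
  rewrite /G pickleK -[h b m](marker_last u') -(join_odd g (marker u' (h b))) -ey.
  exact: fy.
pose In k := ~ functional (prog k) (point (st k)) (point (st k)).
pose X (I : set (nat -> bool)) : mass_problem := [set y |
  (y 0 = 0 /\ B (stail y)) \/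
  exists k x, [/\ y 0 = (st k).1.+1, stail y = join (st k).2 x &
    (In k /\ x = zero) \/ (~ In k /\ exists u a, I a /\ x = marker u (h a))]].
have stA k : A0 (st k).2 by case: (Hst k).
have fresh i k : i < k -> (st k).1 <> (st i).1 /\
    forall y, functional (prog i) (point (st i)) y -> y 0 <> (st k).1.+1.
  move=> ik; have [_ + _] := Hst k => /(_ i); rewrite size_mkseq nth_mkseq//; exact.
have diag k y : functional (prog k) (point (st k)) y ->
    ~ (y 0 = 0 /\ B (stail y)) /\ forall i, i < k -> y <> point (st i).
  have [_ _] := Hst k; rewrite size_mkseq => + fy => /(_ y fy)[nB ni]; split=> // i ik.
  by have := ni i ik; rewrite nth_mkseq.
exists X; split=> [I|I J a Ja nIa]; [split|].
(* There are infinitely many tags, but all positive ones share a reduction: the left half of the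
   tail lies in [A0]. *)
- apply: (@medvedev_le_cases _ _ (Comp prog_pos [:: Query]) 2) => [y _|].
    by exists (0 < y 0 : nat); [case: (0 < y 0)|apply: run_Comp1 (run_pos _ _)].
  have pos_y (y : nat -> nat) j : run y (Comp prog_pos [:: Query]) [:: 0] j -> j = (0 < y 0).
    by move=> r; apply: run_det r _; apply: run_Comp1 (run_pos _ _).
  move=> [_|[_|//]].
  + apply: medvedev_le_trans A_le_B (medvedev_le_trans (medvedev_le_tail B) _).
    apply: medvedev_le_sub => y [[[_ ?//]|[k [x [y0 _ _]]]]] /pos_y.
    by rewrite y0.
  + apply: medvedev_le_trans A_le_A0 _; apply/medvedev_leP.
    exists (oracle_subst prog_tail prog_left) => y [[[y0 _]|[k [x [_ ey _]]]]] /pos_y.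
      by rewrite y0.
    move=> _; exists (st k).2 => //; apply: functional_comp (functional_tail _) _.
    by rewrite ey; exact: functional_left.
- by apply: medvedev_le_trans (medvedev_le_cons 0 B); apply: medvedev_le_sub => y; left.
- move=> /medvedev_leP[p]; have [k <-] := program_of_nat_surj p; rewrite -/prog => red.
  have [Ik|nIk] := pselect (In k).
    have [|y Xy fy] := red (point (st k)).
      by right; exists k, zero; split=> //; left.
    have [nB ni] := diag k y fy.
    case: Xy => [//|[j [x [y0 ey Hx]]]]; case: (ltngtP j k) => [jk|kj|jk].
    + case: Hx => -[Ij]; first by move=> x0; apply: (ni j jk); rewrite -(scons_stail y) y0 ey x0.
      move=> [u [b [_ xb]]]; rewrite xb in ey.
      (* The bare point depends on no index, so any index other than [b] will do, such as its
         complement. *)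
      apply: (@no_marker false k 0 u (fun n => ~~ b n) b _ y _ fy ey).
      by move=> /(congr1 (fun c => c 0)); case: (b 0).
    + by have [_ /(_ y fy)] := fresh k j kj.
    + case: Hx => -[Ij]; last by rewrite jk in Ij.
      by move=> x0; apply: Ik; move: fy; rewrite -[y]scons_stail y0 ey x0 jk.
  have fk : functional (prog k) (point (st k)) (point (st k)) by apply: contrapT.
  have [m Hm] := run_continuous (fk 0).
  (* A marker of length [m] keeps the part of the oracle that decides the output tag. The output
     must then contain some [h b] with [b] in [I], whereas [a] is not in [I]. *)
  pose z := scons (st k).1.+1 (join (st k).2 (marker m (h a))).
  have [|y Xy fy] := red z.
    by right; exists k, (marker m (h a)); split=> //; right; split=> //; exists m, a.
  have y0 : y 0 = (st k).1.+1.
    apply: run_det (fy 0) (Hm _ _); apply: scons_agree; apply: join_agree => i im.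
    by rewrite /marker /splice im.
  case: Xy => [[]|[j [x [y0' ey Hx]]]]; first by rewrite y0.
  have jk : j = k.
    have e : (st j).1 = (st k).1 by move: y0'; rewrite y0 => -[].
    by case: (ltngtP j k) => // /fresh[ne _]; case: ne; rewrite e.
  rewrite jk in Hx ey; case: Hx => [[/nIk//]|[_ [u [b [Ib xb]]]]]; rewrite xb in ey.
  apply: (@no_marker true k m u a b _ y _ fy ey) => ab.
  by apply: nIa; rewrite ab.
Qed.

(** Each [S] is coded as the disjoint sum of [S] and its complement, which makes codes of distinct
    sets incomparable under inclusion. *)
Lemma incomparable_family_powerset : exists X : set (set nat) -> mass_problem,
  (forall S, medvedev_le A (X S) /\ medvedev_le (X S) B) /\
  (forall S T, S <> T -> ~ medvedev_le (X S) (X T)).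
Proof.
have [X [XAB Xinc]] := incomparable_family.
pose code (S : set (set nat)) : set (nat -> bool) :=
  [set a | if a 0 then S [set n | a n.+1] else ~ S [set n | a n.+1]].
exists (fun S => X (code S)); split=> [S|S T ST]; first exact: XAB.
have [n nST] : exists n, ~ (S n <-> T n).
  apply: contrapT => nn; apply: ST; apply/funext => n; apply/propext.
  by apply: contrapT => ?; apply: nn; exists n.
pose a b i := if i is j.+1 then `[< n j >] else b.
have aE b : [set i | a b i.+1] = n by apply/funext => i; rewrite /= asboolE.
have codeE R b : code R (a b) = if b then R n else ~ R n by rewrite /code /= aE.
have [Tn|nTn] := pselect (T n).
- by apply: (Xinc _ _ (a true)); rewrite codeE// => Sn; apply: nST.
- by apply: (Xinc _ _ (a false)); rewrite codeE// => nSn; apply: nST.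
Qed.

End Antichain.

(** * Medvedev degrees *)

Definition degree (A : mass_problem) : medvedev_degree :=
  @MedvedevDegree [set X | medvedev_equiv A X] (ex_intro _ A erefl).

Lemma degree_leE A B : degree_le (degree A) (degree B) <-> medvedev_le A B.
Proof.
split=> [[A' [B' [[AA' _] [_ B'B]]]] A'B'|AB].
  exact: medvedev_le_trans AA' (medvedev_le_trans A'B' B'B).
by exists A, B; split=> //; split; exact: medvedev_le_refl.
Qed.

Lemma degree_surj a : exists A, a = degree A.
Proof.
by case: a => c [A cA]; exists A; subst c.
Qed.

Lemma eq_degree A B : medvedev_equiv A B -> degree A = degree B.
Proof.
move=> [AB BA]; have E : [set X | medvedev_equiv A X] = [set X | medvedev_equiv B X].
  apply/seteqP; split=> X [H1 H2]; split; by [apply: medvedev_le_trans H1|apply: medvedev_le_trans H2 _].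
rewrite /degree; move: (ex_intro _ A _) (ex_intro _ B _); rewrite E => p q.
by congr MedvedevDegree; exact: Prop_irrelevance.
Qed.

Lemma large_antichain A B A0 : medvedev_le A A0 -> medvedev_le A B ->
  (forall n (F : 'I_n -> nat -> nat) (S : {set 'I_n}),
     (forall i, i \in S -> A0 (F i)) -> ~ medvedev_le (finite_meet B F S) A0) ->
  exists C : set medvedev_degree,
    [/\ C `<=` degree_interval (degree A) (degree B), degree_antichain C
      & C #= [set: set (set nat)]].
Proof.
move=> AA0 AB nomeet.
have [X [XAB Xinc]] := incomparable_family_powerset AA0 AB nomeet.
pose phi S := degree (X S).
have phi_inj : {in [set: set (set nat)] &, injective phi}.
  move=> S T _ _ e; apply: contrapT => /Xinc; apply.
  by apply/degree_leE; rewrite -/(phi S) e; apply/degree_leE; exact: medvedev_le_refl.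
exists (phi @` setT); split.
- by move=> _ [S _ <-]; have [H1 H2] := XAB S; split; apply/degree_leE.
- move=> _ _ [S _ <-] [T _ <-] ST.
  have neq : S <> T by move=> e; apply: ST; rewrite e.
  by split=> /degree_leE; apply: Xinc => // e; apply: neq.
- exact: inj_card_eq.
Qed.

(** The Turing degrees strictly above [f]: the join of [f] and [h] lies strictly above [f] exactly
    when [h] is not computable from [f]. *)
Definition strict_cone (f : nat -> nat) : mass_problem :=
  [set y | exists2 h, ~ turing_le h f & y = join f h].

Lemma strict_cone_no_finite_meet B f : ~ medvedev_le B (strict_cone f) ->
  forall n (F : 'I_n -> nat -> nat) (S : {set 'I_n}),
    (forall i, i \in S -> strict_cone f (F i)) ->
    ~ medvedev_le (finite_meet B F S) (strict_cone f).
Proof.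
move=> nB n F S FS /medvedev_leP[p Hp]; apply: nB.
(* If all outputs had tag 0, deleting the tag would reduce [B] to the cone. So some output has a
   positive tag, decided by finitely many entries of [h]. *)
have [[x [h [hf ex] [y py y0]]]|allB] := pselect (exists x, exists2 h,
    ~ turing_le h f /\ x = join f h & exists2 y, functional p x y & y 0 <> 0); last first.
  apply/medvedev_leP; exists (oracle_subst p prog_tail) => x [h hf ex].
  have [y My py] := Hp x (ex_intro2 _ _ h hf ex).
  exists (stail y); last exact: functional_comp py (functional_tail y).
  case: My => [[]//|[i iS ey]]; case: allB; exists x, h => //.
  by exists y => //; rewrite ey.
exfalso; have [m Hm] := run_continuous (py 0).
have [s Hs] := functional_splice h m.
have val_p i : i.+1 = y 0 -> forall z, (z 0 = y 0) -> finite_meet B F S z ->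
    exists2 j, j \in S & i = j /\ z = scons j.+1 (F j).
  move=> iy z zy [[z0]|[j jS ez]]; first by rewrite -zy z0 in y0.
  by exists j => //; split=> //; move: iy; rewrite -zy ez => -[].
case E : (y 0) => [//|i]; rewrite E in val_p.
have near_h h' : ~ turing_le h' f -> exists2 j : 'I_n, j \in S &
    i = j /\ functional p (join f (splice h m h')) (scons j.+1 (F j)).
  move=> h'f; have [|z Mz pz] := Hp (join f (splice h m h')).
    exists (splice h m h') => // sf; apply: h'f.
    exact: turing_le_trans (turing_le_splice _ _ _) sf.
  have z0 : z 0 = i.+1.
    rewrite -E; apply: run_det (pz 0) (Hm _ _); rewrite ex.
    by apply: join_agree => k km; rewrite /splice km.
  have [j jS [ij ez]] := val_p i erefl z z0 Mz.
  by exists j => //; split=> //; rewrite -ez.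
(* Prefixing those entries to any [h'] not computable from [f] yields the same [F j]; here [h0] only
   exhibits [j]. By cone avoidance [F j] is computable from [f], although it lies in the strict
   cone. *)
have [h0 h0f] := exists_not_turing_le f.
have [j jS [ij _]] := near_h h0 h0f.
have [g gf Fj] := FS j jS.
apply: gf; apply: (@turing_le_trans _ (F j)); first by exists prog_right; rewrite Fj; exact: functional_right.
apply: (@cone_avoidance f (F j)
  (oracle_subst (oracle_subst (prog_join prog_left (oracle_subst prog_right s)) p) prog_tail)).
move=> h' h'f; have [j' j'S [ij' pj']] := near_h h' h'f.
have -> : j = j' by apply/val_inj; rewrite /= -ij.
apply: (@functional_comp _ _ _ (scons j'.+1 (F j'))); last exact: functional_tail.
apply: functional_comp pj'.
apply: functional_join; first exact: functional_left.
exact: functional_comp (functional_right _ _) (Hs _).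
Qed.

(** * Intervals isomorphic to a finite Boolean algebra *)

Section BooleanInterval.
Variables (B : mass_problem) (n : nat) (F : 'I_n -> nat -> nat) (S : {set 'I_n}).
Hypothesis F_indep : forall i, i \in S ->
  ~ medvedev_le (finite_meet B F (S :\ i)) [set F i].
Hypothesis B_le_cone : forall i, i \in S -> medvedev_le B (strict_cone (F i)).

(** For [i] in [V] but not in [U], the meet over [S :\ i] would reduce to [F i], against
    [F_indep]. *)
Lemma finite_meet_leE (U V : {set 'I_n}) : U \subset S -> V \subset S ->
  medvedev_le (finite_meet B F U) (finite_meet B F V) <-> V \subset U.
Proof.
move=> US VS; split; last exact: finite_meet_mono.
move=> UV; apply/fintype.subsetP => i iV; apply: contrapT => /negP iU.
apply: (F_indep (fintype.subsetP VS i iV)).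
apply: medvedev_le_trans (medvedev_le_trans UV (finite_meet_le1 _ _ iV)).
by apply: finite_meet_mono; rewrite subsetD1 US.
Qed.

(** [U] collects the [i] for which [F i] computes a member of [X]. Split [X] by the output tag of
    [p]. Tag 0 gives a member of [B], and a tag from [U] gives its point. For other [i] in [S], [x]
    is not computable from [F i], so their join lies in the strict cone and computes a member of
    [B]. *)
Lemma interval_finite_meet X :
  medvedev_le (finite_meet B F S) X -> medvedev_le X B ->
  exists2 U : {set 'I_n}, U \subset S & medvedev_equiv X (finite_meet B F U).
Proof.
move=> /medvedev_leP[p Hp] XB.
pose U := [set i in S | `[< exists2 x, X x & turing_le x (F i) >]]%SET.
exists U; first by apply/fintype.subsetP => i; rewrite inE => /andP[].
split.
  apply: le_finite_meet => // i; rewrite inE => /andP[_ /asboolP[x Xx xF]].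
  exact: medvedev_le_set1 xF.
apply: (@medvedev_le_cases _ _ p n.+1) => [x /Hp[y My py]|j jn].
  exists (y 0) => //; case: My => [[->]//|[i _ ->]] /=.
  by rewrite ltnS.
have tag x y : X x /\ run x p [:: 0] j -> functional p x y -> y 0 = j.
  by move=> [_ rj] py; exact: run_det (py 0) rj.
case: j jn tag => [_|j jn] tag.
  apply: medvedev_le_trans (finite_meet_le B F U) _.
  apply/medvedev_leP; exists (oracle_subst p prog_tail) => x xP.
  have [y My py] := Hp x xP.1; exists (stail y); last exact: functional_comp py (functional_tail _).
  by have := tag x y xP py; case: My => [[]//|[i _ ->]].
pose i := Ordinal (jn : j < n).
have [iU|iU] := boolP (i \in U).
  apply: medvedev_le_trans (finite_meet_le1 B F iU) _.
  apply/medvedev_leP; exists (oracle_subst p prog_tail) => x xP.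
  have [y My py] := Hp x xP.1; exists (stail y); last exact: functional_comp py (functional_tail _).
  have := tag x y xP py; case: My => [[-> _]//|[i' _ -> [ij]]] /=.
  by congr F; apply/val_inj.
have [iS|iS] := boolP (i \in S); last first.
  apply: medvedev_le_sub => x xP; have [y My py] := Hp x xP.1.
  have := tag x y xP py; case: My => [[-> _]//|[i' i'S -> [ij]]].
  by move: iS; rewrite (_ : i = i') ?i'S//; apply/val_inj.
apply: medvedev_le_trans (finite_meet_le B F U) (medvedev_le_trans (B_le_cone iS) _).
apply/medvedev_leP; exists (prog_join (oracle_subst p prog_tail) Query) => x xP.
have [y My py] := Hp x xP.1.
exists (join (F i) x).
  exists x => // xF; move/negP: iU; apply; rewrite inE iS /=.
  by apply/asboolP; exists x => //; case: xP.
apply: functional_join (functional_id _).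
have := tag x y xP py; case: My => [[-> _]//|[i' _ ey]] e.
have -> : F i = stail y.
  by move: e; rewrite ey => -[ij] /=; apply/funext => k; rewrite /stail /=; congr F; apply/val_inj.
exact: functional_comp py (functional_tail _).
Qed.

Lemma boolean_interval A : medvedev_equiv A (finite_meet B F S) ->
  iso_powerset #|S| (degree_interval (degree A) (degree B)).
Proof.
move=> [AS SA].
(* More points make a lower meet, so the complement in [S] restores the order. *)
pose V (T : {set 'I_#|S|}) : {set 'I_n} := S :\: [set enum_val j | j in T].
have VS T : V T \subset S by exact: subsetDl.
have mem_V (T : {set 'I_#|S|}) (j : 'I_#|S|) : (enum_val j \in V T) = (j \notin T).
  by rewrite inE enum_valP andbT mem_imset//; exact: enum_val_inj.
have V_sub T T' : (V T' \subset V T) = (T \subset T').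
  apply/fintype.subsetP/fintype.subsetP => sub.
    by move=> j jT; have := sub (enum_val j); rewrite !mem_V jT; case: (j \in T') => // /(_ isT).
  move=> i; have [iS|iS] := boolP (i \in S); last by rewrite !inE (negbTE iS) !andbF.
  rewrite -(enum_rankK_in iS iS) !mem_V; exact/contra/sub.
have leE (T T' : {set 'I_#|S|}) : T \subset T' <->
    degree_le (degree (finite_meet B F (V T))) (degree (finite_meet B F (V T'))).
  rewrite -V_sub; have := finite_meet_leE (VS T) (VS T').
  by have := degree_leE (finite_meet B F (V T)) (finite_meet B F (V T')); tauto.
exists (fun T => degree (finite_meet B F (V T))); split=> //; split.
- move=> T _; split; apply/degree_leE; last exact: finite_meet_le.
  exact: medvedev_le_trans AS (finite_meet_mono _ _ (VS T)).
- move=> T T' _ _ e; apply/eqP; rewrite finset.eqEsubset; apply/andP; split; apply/leE; rewrite e;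
    apply/degree_leE; exact: medvedev_le_refl.
- move=> c [/=]; have [X ->] := degree_surj c => /degree_leE AX /degree_leE XB.
  have [U US [XU UX]] := interval_finite_meet (medvedev_le_trans SA AX) XB.
  exists [set j | enum_val j \notin U]%SET => //; apply: eq_degree.
  suff -> : V [set j | enum_val j \notin U]%SET = U by [].
  apply/setP => i; have [iS|iS] := boolP (i \in S).
    by rewrite -(enum_rankK_in iS iS) mem_V inE negbK.
  by rewrite inE (negbTE iS) andbF; apply/esym/negP => /(fintype.subsetP US); exact/negP.
Qed.

End BooleanInterval.

Theorem theorem2p10 (a b : medvedev_degree) (hab : degree_lt a b) :
  (exists n : nat, 1 <= n /\ iso_powerset n (degree_interval a b)) \/
  (exists C : set medvedev_degree,
     [/\ C `<=` degree_interval a b,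
         degree_antichain C
       & C #= [set: set (set nat)]]).
Proof.
have [A aA] := degree_surj a; have [B bB] := degree_surj b; subst a b.
move: hab => [/degree_leE AB nBA]; have {}nBA : ~ medvedev_le B A by move/degree_leE.
have [[n [F [S0 [S0A S0_le]]]]|nomeet] := pselect 
    (exists n (F : 'I_n -> nat -> nat) (S : {set 'I_n}),
    (forall i, i \in S -> A (F i)) /\ medvedev_le (finite_meet B F S) A); last first.
  right; apply: (large_antichain (medvedev_le_refl A) AB) => n F S SA S_le.
  by apply: nomeet; exists n, F, S.
(* A good set of least cardinality makes its points independent of one another modulo [B]. *)
pose good (S : {set 'I_n}) := (S \subset S0) && `[< medvedev_le (finite_meet B F S) A >].
have good0 : good S0 by rewrite /good subxx; apply/asboolP.
case: (arg_minnP (fun S : {set 'I_n} => #|S|) good0) => S /andP[SS0 /asboolP S_le] S_min.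
have SA i : i \in S -> A (F i) by move=> /(fintype.subsetP SS0); exact: S0A.
have A_F i : i \in S -> medvedev_le A [set F i].
  by move=> /SA AF; apply: medvedev_le_set1 AF _; exists Query.
have A_S : medvedev_le A (finite_meet B F S) by exact: le_finite_meet.
(* The meet over the empty set is equivalent to [B], which does not reduce to [A]. *)
have S_gt0 : 0 < #|S|.
  rewrite card_gt0; apply/eqP => S0E; apply: nBA; apply: medvedev_le_trans S_le.
  by rewrite S0E; apply: le_finite_meet => [|i]; [exact: medvedev_le_refl|rewrite inE].
have F_indep i : i \in S -> ~ medvedev_le (finite_meet B F (S :\ i)) [set F i].
  move=> iS Si; have : good (S :\ i).
    rewrite /good (fintype.subset_trans (subsetDl _ _) SS0); apply/asboolP.
    apply: medvedev_le_trans S_le; apply: le_finite_meet; first exact: finite_meet_le.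
    move=> j jS; have [->//|ji] := eqVneq j i.
    by apply: finite_meet_le1; rewrite in_setD1 ji.
  by move=> /S_min; rewrite (cardsD1 i S) iS add1n ltnn.
have [cones|ncones] := pselect (forall i, i \in S -> medvedev_le B (strict_cone (F i))).
  by left; exists #|S|; split=> //; apply: (boolean_interval F_indep cones); split.
right; have [i [iS nB]] : exists i, i \in S /\ ~ medvedev_le B (strict_cone (F i)).
  apply: contrapT => no; apply: ncones => i iS; apply: contrapT => nB.
  by apply: no; exists i.
(* The cone takes the place of [A0]: the left half of each of its elements is [F i], a point of
   [A]. *)
apply: (@large_antichain _ _ (strict_cone (F i))) => //; last exact: strict_cone_no_finite_meet.
apply: medvedev_le_trans (A_F i iS) _; apply/medvedev_leP.
by exists prog_left => _ [h _ ->]; exists (F i) => //; exact: functional_left.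
Qed.
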